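(* Let $n\ge 3$, let $0\le m\le k$, let $H\lhd W_k=\mathop{\wr}\limits_{i=0}^{k}S_n$ be a normal subgroup, let $1\le s\le n^{k-m}$, and let $St_H(B^s_{n^m})$ be the setwise stabilizer in $H$ of the block $B^s_{n^m}$. Then $St_H(B^s_{n^m})$ fixes (setwise) each block in the orbit of the block $B^s_{n^m}$ under the action of $H$ if and only if $St_H(B^s_{n^m})\lhd H$.
   Context: $W_k$ is the iterated permutational wreath product of $k+1$ copies of $S_n$, acting by automorphisms on the $n$-regular rooted tree; $X^k$ is the set of the $n^k$ vertices of level $k$ (the root being level $0$), numbered $1,\dots,n^k$ in the natural (lexicographic) order. The block $B^s_{n^m}$ is the set of the $n^m$ vertices of $X^k$ with numbers $(s-1)n^m+1,\dots,sn^m$, $1\le s\le n^{k-m}$ (equivalently, the vertices of $X^k$ lying below a single vertex of level $k-m$); these blocks are permuted by $W_k$. The setwise stabilizer is $St_H(B)=\{h\in H: h(B)=B\}$. *)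

(* Defs.v *)
From HB Require Import structures.
From mathcomp Require Import all_boot all_order all_fingroup.

Set Implicit Arguments.
Unset Strict Implicit.
Unset Printing Implicit Defensive.

Import GroupScope.

(* Products of permutations are read left to right in MathComp, so all the    *)
(* groups below act on the right: to x (g * h) = to (to x g) h.               *)

Section WreathProduct.

Variables (gT Q : finGroupType) (X : finType) (to : {action Q &-> X}).

Definition base_act (f : {dffun forall _ : X, gT}) (q : Q) :
    {dffun forall _ : X, gT} :=
  [ffun x => f (to x q^-1)].

Lemma base_act1 : base_act^~ 1 =1 id.
Proof. by move=> f; apply/ffunP=> x; rewrite ffunE invg1 act1. Qed.

Lemma base_actM f : act_morph base_act f.
Proof. by move=> p q; apply/ffunP=> x; rewrite !ffunE invMg actM. Qed.

Definition base_action := TotalAction base_act1 base_actM.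

Lemma base_is_groupAction : is_groupAction [set: _] base_action.
Proof.
move=> q _; rewrite inE; apply/andP; split.
  by apply/subsetP=> f; rewrite inE.
apply/morphicP=> f g _ _; rewrite !actpermE.
by apply/ffunP=> x; rewrite !(ffunE, mulg_ffun).
Qed.

Canonical base_groupAction := GroupAction base_is_groupAction.

(* The element (q, f) is q followed by f: it sends a point y of the x-th copy *)
(* of a gT-set to the point y . f (x . q) of the (x . q)-th copy.             *)
Definition wreath : finGroupType := sdprod_by base_groupAction.

End WreathProduct.

Section IteratedWreathProduct.

Variable n : nat.

(* k.+1 copies of 'S_n; the outermost one is the label of the root.           *)
Fixpoint iter_wreath (k : nat) : finGroupType :=
  if k is k'.+1 then wreath (iter_wreath k') ('P : {action 'S_n &-> 'I_n})
  else 'S_n.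

(* The vertices of the n-regular rooted tree are the words over 'I_n, the     *)
(* root being the empty word. iter_wreath k has labels on the levels          *)
(* 0, ..., k only, so the letters of index > k are left unchanged.            *)
Fixpoint word_act (k : nat) : seq 'I_n -> iter_wreath k -> seq 'I_n :=
  match k with
  | 0 => fun w (g : 'S_n) => if w is x :: v then g x :: v else [::]
  | k'.+1 => fun w (g : wreath (iter_wreath k') ('P : {action 'S_n &-> 'I_n})) =>
      if w is x :: v then g.1 x :: word_act v (g.2 (g.1 x)) else [::]
  end.

Lemma size_word_act k w (g : iter_wreath k) : size (word_act w g) = size w.
Proof. by elim: k w g => [|k IHk] [|x w] g //=; rewrite IHk. Qed.

Lemma take_word_act k i w (g : iter_wreath k) :
  take i (word_act w g) = word_act (take i w) g.
Proof. by elim: k i w g => [|k IHk] [|i] [|x w] g //=; rewrite IHk. Qed.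

Lemma word_act1 k w : word_act w (1 : iter_wreath k) = w.
Proof.
elim: k w => [|k IHk] [|x w] //=; first by rewrite perm1.
by rewrite perm1 oneg_ffun IHk.
Qed.

Lemma word_actM k w (g h : iter_wreath k) :
  word_act w (g * h) = word_act (word_act w g) h.
Proof.
elim: k w g h => [|k IHk] [|x w] g h //=; first by rewrite permM.
by rewrite permM mulg_ffun ffunE /= apermE permK IHk.
Qed.

Definition level_act (k j : nat) (w : j.-tuple 'I_n) (g : iter_wreath k) :
    j.-tuple 'I_n :=
  insubd w (word_act w g).

Lemma val_level_act k j (w : j.-tuple 'I_n) (g : iter_wreath k) :
  val (level_act w g) = word_act w g.
Proof. by rewrite val_insubd size_word_act size_tuple eqxx. Qed.

Lemma level_act1 k j : (@level_act k j)^~ 1 =1 id.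
Proof. by move=> w; apply: val_inj; rewrite val_level_act word_act1. Qed.

Lemma level_actM k j w : act_morph (@level_act k j) w.
Proof.
by move=> g h; apply: val_inj; rewrite !val_level_act word_actM.
Qed.

Definition level_action k j : {action iter_wreath k &-> j.-tuple 'I_n} :=
  TotalAction (@level_act1 k j) (@level_actM k j).

(* The number of a vertex in the lexicographic order of its level, from 1.    *)
Definition vertex_number (j : nat) (w : j.-tuple 'I_n) : nat :=
  #|[set u : j.-tuple 'I_n |
      ((u : j.-tuplelexi 'I_n) <= (w : j.-tuplelexi 'I_n))%O]|.

Definition block (k m s : nat) : {set k.-tuple 'I_n} :=
  [set w | ((s - 1) * n ^ m < vertex_number w <= s * n ^ m)%N].

End IteratedWreathProduct.

(* Main.v *)
Require Import Defs.
From mathcomp Require Import all_boot all_order all_fingroup.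

Import GroupScope.

(** The equivalence holds for every group action.  Let N be the stabilizer in H
    of a point x.  The points of the orbit of x are the x . a with a in H, and
    the stabilizer in H of x . a is the conjugate N ^ a.  So N fixes the whole
    orbit exactly when N lies in each of its conjugates N ^ a, which, as N and
    N ^ a have the same order, says that H normalizes N.

    This is [point_stabilizer_normalP].  It applies to blocks because the
    setwise stabilizer of a block is its stabilizer as a point for the induced
    action on sets of vertices. *)

(** Both sides say that N = 'C_H[x | to] is contained in, hence equal to, each
    N :^ a = 'C_H[to x a | to] with a in H. *)
Lemma point_stabilizer_normalP (aT : finGroupType) (rT : finType)
    (to : {action aT &-> rT}) (H : {group aT}) (x : rT) :
  (forall y, y \in orbit to H x -> forall h, h \in 'C_H[x | to] -> to y h = y)
  <-> 'C_H[x | to] <| H.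
Proof.
have stabJ a : a \in H -> 'C_H[to x a | to] = 'C_H[x | to] :^ a.
  by move=> Ha; rewrite conjIg conjGid // astab1_act.
rewrite /normal subsetIl /=; split=> [fixN | nNH y /orbitP[a Ha <-] h Nh].
  apply/normsP=> a Ha; apply/eqP.
  (* The orders agree, so one of the two inclusions is enough. *)
  rewrite eq_sym eqEcard cardJg leqnn andbT -stabJ //.
  apply/subsetP=> h Nh; have /setIP[Hh _] := Nh.
  rewrite inE Hh; apply/astab1P.
  by apply: fixN Nh; apply: mem_orbit.
have: h \in 'C_H[to x a | to] by rewrite stabJ // (normsP nNH).
by case/setIP=> _ /astab1P.
Qed.

Theorem proposition21 (n k m s : nat) (H : {group iter_wreath n k})
    (hn : (3 <= n)%N) (hmk : (m <= k)%N)
    (hH : H <| [set: iter_wreath n k])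
    (hs : (1 <= s <= n ^ (k - m))%N) :
  (forall C : {set k.-tuple 'I_n},
     C \in orbit (level_action n k k)^* H (block n k m s) ->
     forall h : iter_wreath n k,
       h \in 'N_H(block n k m s | level_action n k k) ->
       ((level_action n k k)^*)%act C h = C) <->
  'N_H(block n k m s | level_action n k k) <| H.
Proof. by rewrite -astab1_set; apply: point_stabilizer_normalP. Qed.
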